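(* Let $n,k\ge 1$ and let $Q_1,\dots,Q_k\in\mathbb{R}^{n\times n}$ be symmetric positive definite matrices. Let $\mathcal{H}=\bigoplus_{i=1}^k\mathcal{E}(Q_i)$ be the geometric (Minkowski) sum of the corresponding ellipsoids. Let $\mathcal{I}=\{(i,j)\in\mathbb{N}^2 : 1\le i<j\le k\}$, let $p_{ij}>0$ be real numbers for $(i,j)\in\mathcal{I}$, and put $$Q_u=\sum_{i=1}^kQ_i+\sum_{(i,j)\in\mathcal{I}}\left(p_{ij}Q_i+p_{ij}^{-1}Q_j\right).$$ Let $Q_0\in\mathbb{R}^{n\times n}$ be a symmetric matrix such that 1. $Q_0+Q_u$ is positive definite, and 2. $\langle \ell,(Q_0+Q_u)\ell\rangle^{\frac12}\ge\sum_{i=1}^k\langle \ell,Q_i\ell\rangle^{\frac12}$ for all $\ell$ in the unit ball $\mathcal{B}_1(0)$ of $\mathbb{R}^n$. Then, with $Q=Q_0+Q_u$, the ellipsoid $\mathcal{E}(Q)$ is an outer bound of $\mathcal{H}$, i.e. $\mathcal{H}\subseteq\mathcal{E}(Q)$.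
   Context: For a symmetric positive definite matrix $Q\in\mathbb{R}^{n\times n}$, $\mathcal{E}(Q)=\{\xi\in\mathbb{R}^n : \xi^TQ^{-1}\xi\le 1\}$ is the ellipsoid centered at the origin with shape matrix $Q$. The geometric (Minkowski) sum of sets $\mathcal{S}_1,\dots,\mathcal{S}_k\subset\mathbb{R}^n$ is $\bigoplus_{i=1}^k\mathcal{S}_i=\{s_1+\cdots+s_k : s_i\in\mathcal{S}_i\}$. $\langle\cdot,\cdot\rangle$ is the Euclidean inner product and $\mathcal{B}_1(0)$ is the unit ball centered at the origin. *)

(* Defs.v *)
From mathcomp Require Import all_boot all_order all_algebra.
From mathcomp Require Import classical_sets reals.

Set Implicit Arguments.
Unset Strict Implicit.
Unset Printing Implicit Defensive.

Import Order.TTheory GRing.Theory Num.Theory.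

Local Open Scope classical_set_scope.
Local Open Scope ring_scope.

Definition dotv (R : realType) (n : nat) (x y : 'cV[R]_n) : R :=
  \sum_(i < n) x i 0 * y i 0.

(* MathComp-Analysis's norm on matrices is the sup norm, hence a separate
   Euclidean norm. *)
Definition enorm (R : realType) (n : nat) (x : 'cV[R]_n) : R :=
  Num.sqrt (dotv x x).

(* Closed unit ball of the Euclidean norm, not of the sup norm. *)
Definition unit_ball (R : realType) (n : nat) : set 'cV[R]_n :=
  [set l | enorm l <= 1].

(* Symmetry is not included; it is always required separately. *)
Definition posdefmx (R : realType) (n : nat) (Q : 'M[R]_n) : Prop :=
  forall x : 'cV[R]_n, x != 0 -> 0 < dotv x (Q *m x).

(* Only meaningful for a symmetric positive definite [Q]: [invmx Q] is [Q]
   itself when [Q] is singular. *)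
Definition ellipsoid (R : realType) (n : nat) (Q : 'M[R]_n) : set 'cV[R]_n :=
  [set x | (x^T *m invmx Q *m x) 0 0 <= 1].

Definition minkowski_sum (R : realType) (n k : nat)
    (S : 'I_k -> set 'cV[R]_n) : set 'cV[R]_n :=
  [set x | exists2 s : 'I_k -> 'cV[R]_n,
             forall i, S i (s i) & x = \sum_(i < k) s i].

(* [p] is total on pairs of indices, but only its values at [i < j] are used. *)
Definition shape_u (R : realType) (n k : nat)
    (Q : 'I_k -> 'M[R]_n) (p : 'I_k -> 'I_k -> R) : 'M[R]_n :=
  \sum_(i < k) Q i
  + \sum_(ij : 'I_k * 'I_k | (ij.1 < ij.2)%N)
      (p ij.1 ij.2 *: Q ij.1 + (p ij.1 ij.2)^-1 *: Q ij.2).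

(* Main.v *)
(* Put [l = Q^-1 x] for [x] in the Minkowski sum.  Then [<l, x> = x^T Q^-1 x],
   while Cauchy-Schwarz for each [Q_i] together with the hypothesis on [Q]
   (homogeneous, hence valid for all [l]) gives
   [<l, x> <= sum_i <l, Q_i l>^(1/2) <= <l, Q l>^(1/2) = <l, x>^(1/2)]. *)

Require Import Defs.
From mathcomp Require Import all_boot all_order all_algebra.
From mathcomp Require Import classical_sets reals.
From mathcomp Require Import sesquilinear ring lra.

Import Order.TTheory GRing.Theory Num.Theory.

Local Open Scope classical_set_scope.
Local Open Scope ring_scope.

Lemma dotvE (R : realType) (n : nat) (x y : 'cV[R]_n) :
  dotv x y = (x^T *m y) 0 0.
Proof. by rewrite mxE; apply: eq_bigr => i _; rewrite mxE. Qed.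

Lemma dotvDl (R : realType) (n : nat) (x y z : 'cV[R]_n) :
  dotv (x + y) z = dotv x z + dotv y z.
Proof. by rewrite !dotvE linearD mulmxDl mxE. Qed.

Lemma dotvDr (R : realType) (n : nat) (x y z : 'cV[R]_n) :
  dotv x (y + z) = dotv x y + dotv x z.
Proof. by rewrite !dotvE mulmxDr mxE. Qed.

Lemma dotvZl (R : realType) (n : nat) (a : R) (x y : 'cV[R]_n) :
  dotv (a *: x) y = a * dotv x y.
Proof. by rewrite !dotvE linearZ -scalemxAl mxE. Qed.

Lemma dotvZr (R : realType) (n : nat) (a : R) (x y : 'cV[R]_n) :
  dotv x (a *: y) = a * dotv x y.
Proof. by rewrite !dotvE -scalemxAr mxE. Qed.

Lemma dotv_sumr (R : realType) (n k : nat) (x : 'cV[R]_n)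
    (s : 'I_k -> 'cV[R]_n) :
  dotv x (\sum_(i < k) s i) = \sum_(i < k) dotv x (s i).
Proof.
rewrite dotvE mulmx_sumr summxE.
by apply: eq_bigr => i _; rewrite dotvE.
Qed.

Lemma dotvC (R : realType) (n : nat) (x y : 'cV[R]_n) : dotv x y = dotv y x.
Proof. by apply: eq_bigr => i _; rewrite mulrC. Qed.

Lemma dotv_trmx (R : realType) (n : nat) (Q : 'M[R]_n) (x y : 'cV[R]_n) :
  dotv x (Q *m y) = dotv (Q^T *m x) y.
Proof. by rewrite !dotvE trmx_mul trmxK mulmxA. Qed.

Lemma dotv_gt0 (R : realType) (n : nat) (x : 'cV[R]_n) :
  x != 0 -> 0 < dotv x x.
Proof.
move=> x_neq0; rewrite lt_neqAle sumr_ge0 ?andbT => [|i _]; last first.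
  exact: sqr_ge0.
apply: contraNneq x_neq0 => /esym/eqP.
rewrite psumr_eq0 => [/allP x0|i _]; last exact: sqr_ge0.
apply/eqP/colP => i; rewrite mxE; apply/eqP.
by have := x0 i (mem_index_enum i); rewrite mulf_eq0 orbb.
Qed.

Lemma posdefmx_ge0 (R : realType) (n : nat) (Q : 'M[R]_n) (x : 'cV[R]_n) :
  posdefmx Q -> 0 <= dotv x (Q *m x).
Proof.
move=> Qpd; have [->|/Qpd/ltW//] := eqVneq x 0.
by rewrite mulmx0 dotvE mulmx0 mxE.
Qed.

(** A row [v] with [v *m Q = 0] makes the quadratic form vanish at [v^T], which forces [v = 0]. This
    makes [invmx Q] a genuine inverse. *)
Lemma posdefmx_unit (R : realType) (n : nat) (Q : 'M[R]_n) :
  posdefmx Q -> Q \in unitmx.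
Proof.
move=> Qpd; rewrite -row_free_unit -kermx_eq0; apply/rowV0P => v /sub_kermxP vQ.
have [//|v_neq0] := eqVneq v 0; have := Qpd v^T.
by rewrite trmx_eq0 dotvE trmxK mulmxA vQ mul0mx mxE ltxx => /(_ v_neq0).
Qed.

(** Cauchy-Schwarz for the inner product [<x, Q y>], applied to [l] and [m = Q^-1 s]: the squared
    length of [m] in it is [s^T Q^-1 s <= 1]. The bound is the support function of the ellipsoid. *)
Lemma ellipsoid_support (R : realType) (n : nat) (Q : 'M[R]_n) (l s : 'cV[R]_n) :
  Q \is symmetricmx -> posdefmx Q -> ellipsoid Q s ->
  dotv l s <= Num.sqrt (dotv l (Q *m l)).
Proof.
move=> /is_hermitianmxP; rewrite expr0 scale1r map_mx_id // => Qsym Qpd.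
have Qu : Q \in unitmx by exact: posdefmx_unit.
rewrite /ellipsoid /= -mulmxA -dotvE; set m := invmx Q *m s.
have -> : s = Q *m m by rewrite /m mulKVmx.
rewrite dotvC; set c := dotv m _ => c_le1; set b := dotv _ _.
(* By symmetry of [Q], the two cross terms in the expansion below coincide. *)
have bE : dotv m (Q *m l) = b by rewrite dotv_trmx -Qsym dotvC.
set a := dotv l _.
(* Nonnegativity of the quadratic form at [l - b m] gives
   [a >= b^2 (2 - c) >= b^2]. *)
have : 0 <= a - 2 * b ^+ 2 + b ^+ 2 * c.
  suff <- : dotv (l - b *: m) (Q *m (l - b *: m)) =
            a - 2 * b ^+ 2 + b ^+ 2 * c by exact: posdefmx_ge0.
  rewrite -scaleNr mulmxDr -scalemxAr !(dotvDl, dotvDr, dotvZl, dotvZr).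
  by rewrite bE -/a -/b -/c; ring.
move=> q_ge0; have b2_le : b ^+ 2 <= a.
  by have := ler_wpM2l (sqr_ge0 b) c_le1; lra.
by rewrite (le_trans (ler_norm b))// -sqrtr_sqr ler_wsqrtr.
Qed.

(** Serves to extend an inequality that is positively homogeneous in [l] from the ball to the whole
    space. *)
Lemma unit_ball_scale (R : realType) (n : nat) (l : 'cV[R]_n) :
  exists2 c : R, 0 < c & unit_ball (c *: l).
Proof.
have [->|/dotv_gt0 l_gt0] := eqVneq l 0.
  exists 1 => //; rewrite /unit_ball /= /enorm scaler0 dotvE mulmx0 mxE.
  by rewrite sqrtr0.
have e_gt0 : 0 < enorm l by rewrite sqrtr_gt0.
exists (enorm l)^-1; first by rewrite invr_gt0.
rewrite /unit_ball /= {1}/enorm dotvZl dotvZr mulrA -expr2.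
rewrite sqrtrM ?sqr_ge0// sqrtr_sqr gtr0_norm ?invr_gt0//.
by rewrite -/(enorm l) mulVf ?gt_eqF.
Qed.

Lemma sqrt_quadZ (R : realType) (n : nat) (Q : 'M[R]_n) (c : R) (l : 'cV[R]_n) :
  0 < c -> Num.sqrt (dotv (c *: l) (Q *m (c *: l))) =
           c * Num.sqrt (dotv l (Q *m l)).
Proof.
move=> c_gt0; rewrite -scalemxAr dotvZl dotvZr mulrA -expr2.
by rewrite sqrtrM ?sqr_ge0// sqrtr_sqr gtr0_norm.
Qed.

Theorem theorem2 (R : realType) (n k : nat) (n_ge1 : (1 <= n)%N) (k_ge1 : (1 <= k)%N)
    (Q : 'I_k -> 'M[R]_n)
    (Q_sym : forall i, Q i \is symmetricmx)
    (Q_pd : forall i, posdefmx (Q i))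
    (p : 'I_k -> 'I_k -> R)
    (p_gt0 : forall i j : 'I_k, (i < j)%N -> 0 < p i j)
    (Q0 : 'M[R]_n) (Q0_sym : Q0 \is symmetricmx)
    (Q0u_pd : posdefmx (Q0 + shape_u Q p))
    (Q0u_ge : forall l : 'cV[R]_n, unit_ball l ->
       \sum_(i < k) Num.sqrt (dotv l (Q i *m l))
         <= Num.sqrt (dotv l ((Q0 + shape_u Q p) *m l))) :
  minkowski_sum (fun i => ellipsoid (Q i)) `<=` ellipsoid (Q0 + shape_u Q p).
Proof.
move=> x [s sE xE]; rewrite /ellipsoid /= -mulmxA -dotvE.
set P := Q0 + shape_u Q p in Q0u_pd Q0u_ge *.
set l := invmx P *m x.
have Pl : P *m l = x by rewrite /l mulKVmx// posdefmx_unit.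
rewrite dotvC; set t := dotv l x.
have t_ge0 : 0 <= t by rewrite /t -Pl posdefmx_ge0.
(* Since [P *m l = x], the number [t] is at once the pairing [<l, x>], bounded through the summands
   [s i], and the form [<l, P l>] under the root in the hypothesis on [P]. *)
have t_le : t <= Num.sqrt t.
  apply: (@le_trans _ _ (\sum_(i < k) Num.sqrt (dotv l (Q i *m l)))).
    rewrite /t xE dotv_sumr; apply: ler_sum => i _.
    exact: ellipsoid_support.
  have [c c_gt0 /Q0u_ge] := unit_ball_scale _ _ l.
  (* At [c *: l] both sides of the hypothesis carry the factor [c > 0], which cancels. *)
  under eq_bigr do rewrite sqrt_quadZ//.
  by rewrite -mulr_sumr sqrt_quadZ// ler_pM2l// Pl.
have [//|t_gt1] := leP t 1.
(* For [t > 1] the root [r] of [t] exceeds 1, so [t = r^2 > r], against [t_le]. *)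
have r_gt1 : 1 < Num.sqrt t by rewrite -sqrtr1 ltr_sqrt// (lt_trans ltr01).
by have := sqr_sqrtr t_ge0; nra.
Qed.
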